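(* Let $\Lambda$ be a lattice in a second countable, locally compact abelian group $G$. Let $E_{G,\Lambda}$ denote the quotient of $G\times\widehat G\times\mathbb{C}$ by the equivalence relation given by $(x,\omega,z)\sim(x',\omega',z')$ if and only if there exist $\lambda\in\Lambda$ and $\tau\in\Lambda^\perp$ such that \[ x'=x\lambda,\qquad \omega'=\omega\tau,\qquad z'=\overline{\omega(\lambda)}z. \] Then $E_{G,\Lambda}$ has the structure of a Hermitian line bundle over $X_{G,\Lambda}=(G/\Lambda)\times(\widehat G/\Lambda^\perp)$, with projection $[x,\omega,z]\mapsto([x],[\omega])$ and operations on fibers \[ [x,\omega,z]+[x,\omega,w]=[x,\omega,z+w],\quad \mu[x,\omega,z]=[x,\omega,\mu z],\quad \langle[x,\omega,z],[x,\omega,w]\rangle_{([x],[\omega])}=z\overline w \] for $x\in G$, $\omega\in\widehat G$, $z,w,\mu\in\mathbb{C}$, and the map $\Psi\colon\operatorname{QP}_{G,\Lambda}\to\Gamma(E_{G,\Lambda})$ given by \[ \Psi(F)([x],[\omega])=[x,\omega,F(x,\omega)] \] is an isomorphism of left Hilbert $C(X_{G,\Lambda})$-modules.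
   Context: A lattice $\Lambda$ in $G$ is a discrete subgroup with $G/\Lambda$ compact; $\Lambda^\perp=\{\tau\in\widehat G:\tau(\lambda)=1\ \forall\lambda\in\Lambda\}$. $\operatorname{QP}_{G,\Lambda}$ is the space of continuous $F\colon G\times\widehat G\to\mathbb{C}$ with $F(x\lambda,\omega\tau)=\overline{\omega(\lambda)}F(x,\omega)$ for all $(x,\omega)\in G\times\widehat G$, $(\lambda,\tau)\in\Lambda\times\Lambda^\perp$. It is a left Hilbert $C(X_{G,\Lambda})$-module via $(f\cdot F)(x,\omega)=f([x],[\omega])F(x,\omega)$ and ${}_\bullet\langle F,H\rangle([x],[\omega])=F(x,\omega)\overline{H(x,\omega)}$. For a Hermitian (complex) vector bundle $E$ over a compact Hausdorff space $X$, $\Gamma(E)$ denotes the continuous sections, a left Hilbert $C(X)$-module via $(f\cdot s)(x)=f(x)s(x)$ and ${}_\bullet\langle s,t\rangle(x)=\langle s(x),t(x)\rangle_x$. An isomorphism of left Hilbert $A$-modules is a surjective $A$-linear map preserving the $A$-valued inner products. *)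

(* Defs.v *)
From HB Require Import structures.
From mathcomp Require Import all_boot all_order all_algebra.
From mathcomp Require Import generic_quotient ring_quotient complex.
From mathcomp Require Import all_classical all_reals all_analysis.

Set Implicit Arguments.
Unset Strict Implicit.
Unset Printing Implicit Defensive.

Import Order.TTheory GRing.Theory Num.Theory numFieldNormedType.Exports.

Local Open Scope classical_set_scope.
Local Open Scope quotient_scope.
Local Open Scope ring_scope.

(* The usual topology on C, which the libraries do not attach to [R[i]]. *)
HB.instance Definition _ (R : realType) := NormedModule.copy R[i] R[i]^o.

Lemma conjC_continuous (K : numClosedFieldType) :
  continuous (Num.conj : K -> K).
Proof.
move=> x A; rewrite -!nbhs_ballE => -[e e0 eA].
by exists e => // y xy; apply: eA; move: xy; rewrite /ball/= -rmorphB norm_conjC.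
Qed.

Section continuous_functions.
Variables (R : realType) (X : topologicalType).
Implicit Types f g : X -> R[i].

Definition continuous_pred : {pred X -> R[i]} := fun f => `[< continuous f >].

Lemma continuous_pred_subring : subring_closed continuous_pred.
Proof.
split=> [|f g|f g].
- by apply/asboolP => x; exact: cvg_cst.
- move=> /asboolP cf /asboolP cg; apply/asboolP => x.
  exact: (@cvgB R[i] R[i]) (cf x) (cg x).
- move=> /asboolP cf /asboolP cg; apply/asboolP => x.
  exact: (@cvgM R[i]) (cf x) (cg x).
Qed.

End continuous_functions.

Section continuousType_ring.
Variables (R : realType) (X : topologicalType).
Local Notation CX := (continuousType X R[i]).

Definition continuous_Sub (f : X -> R[i]) (cf : continuous_pred f) : CX :=
  mkcts (asboolW cf).

Lemma continuous_Sub_rect (K : CX -> Type)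
  (IH : forall f cf, K (@continuous_Sub f cf)) u : K u.
Proof.
have cu : continuous_pred (u : X -> R[i]) by apply/asboolP; exact: cts_fun.
by rewrite (_ : u = continuous_Sub cu) //; apply/continuousEP.
Qed.

HB.instance Definition _ :=
  @isSub.Build (X -> R[i]) (@continuous_pred R X) CX
    (@Continuous.sort X R[i]) continuous_Sub continuous_Sub_rect
    (fun _ _ => erefl).
HB.instance Definition _ :=
  GRing.SubChoice_isSubComPzRing.Build (X -> R[i]) (@continuous_pred R X) CX
    (@continuous_pred_subring R X).

Lemma conj_fun_continuous (f : CX) : continuous (fun x => (f x)^*).
Proof.
by move=> x; apply: continuous_comp; [exact: cts_fun|exact: conjC_continuous].
Qed.

Definition conj_fun (f : CX) : CX := mkcts (@conj_fun_continuous f).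

Lemma continuousD (f g : CX) x : (f + g) x = f x + g x.
Proof. by []. Qed.

Lemma continuousM (f g : CX) x : (f * g) x = f x * g x.
Proof. by []. Qed.

End continuousType_ring.

Section pontryagin_dual.
Variables (R : realType) (G : topologicalZmodType).

(* The Pontryagin dual of [G], with the compact-open topology. It is written
   additively: [w + t] is the pointwise product of characters, [0] the trivial
   character and [- w] the complex conjugate of [w]. *)
Record pdual := PDual {
  pdual_fun :> G -> R[i];
  pdual_cts : continuous pdual_fun;
  pdualD : {morph pdual_fun : x y / x + y >-> x * y};
  pdual_norm : forall x, `|pdual_fun x| = 1 }.

Lemma pdualP (w t : pdual) : w =1 t -> w = t.
Proof.
case: w t => [f fc fD f1] [g gc gD g1] /= /funext fg; subst g.
by congr PDual; exact: Prop_irrelevance.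
Qed.

HB.instance Definition _ := gen_eqMixin pdual.
HB.instance Definition _ := gen_choiceMixin pdual.

Definition pdual_zero : pdual.
Proof.
refine (@PDual (fun=> 1) _ _ _); last by move=> _; exact: normr1.
- by move=> x; exact: cvg_cst.
- by move=> x y; rewrite mulr1.
Defined.

Definition pdual_opp (w : pdual) : pdual.
Proof.
refine (@PDual (fun x => (w x)^* ) _ _ _).
- move=> x; apply: continuous_comp; first exact: pdual_cts.
  exact: conjC_continuous.
- by move=> x y; rewrite pdualD rmorphM.
- by move=> x; rewrite norm_conjC pdual_norm.
Defined.

Definition pdual_add (w t : pdual) : pdual.
Proof.
refine (@PDual (fun x => w x * t x) _ _ _).
- by move=> x; apply: (@cvgM R[i]); exact: pdual_cts.
- by move=> x y; rewrite !pdualD mulrACA.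
- by move=> x; rewrite normrM !pdual_norm mulr1.
Defined.

Fact pdual_addA : associative pdual_add.
Proof. by move=> u v w; apply/pdualP => x /=; rewrite mulrA. Qed.

Fact pdual_addC : commutative pdual_add.
Proof. by move=> u v; apply/pdualP => x /=; rewrite mulrC. Qed.

Fact pdual_add0 : left_id pdual_zero pdual_add.
Proof. by move=> u; apply/pdualP => x /=; rewrite mul1r. Qed.

Fact pdual_addN : left_inverse pdual_zero pdual_opp pdual_add.
Proof.
by move=> u; apply/pdualP => x /=; rewrite mulrC -normCK pdual_norm expr1n.
Qed.

HB.instance Definition _ :=
  GRing.isZmodule.Build pdual pdual_addA pdual_addC pdual_add0 pdual_addN.

HB.instance Definition _ := Topological.copy pdual
  (initial_topology (fun w : pdual => w : {compact-open, G -> R[i]})).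

Lemma pdual_pt0 (w : pdual) : w 0 = 1.
Proof.
have w0 : w 0 != 0 by rewrite -normr_gt0 pdual_norm.
by apply: (mulfI w0); rewrite -pdualD addr0 mulr1.
Qed.

Lemma pdual_ptN (w : pdual) x : w (- x) = (w x)^*.
Proof.
have wx : w x != 0 by rewrite -normr_gt0 pdual_norm.
by apply: (mulfI wx); rewrite -pdualD subrr pdual_pt0 -normCK pdual_norm expr1n.
Qed.

Lemma pdual_cvgP (F : set_system pdual) (w : pdual) : Filter F ->
  F --> w <-> forall (K : set G) (e : R[i]), compact K -> 0 < e ->
    \forall t \near F, forall x, K x -> `|w x - (t : pdual) x| < e.
Proof.
move=> FF; set r := fun t : pdual => t : {compact-open, G -> R[i]}.
have -> : F --> w <-> r @ F --> r w.
  split=> [Fw|Fw A].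
    by move=> A /(@initial_continuous _ _ r w); exact: Fw.
  rewrite nbhsE => -[U [[V oV <-] Vw] UA]; apply: filterS UA _.
  by apply: Fw; exact: open_nbhs_nbhs.
rewrite (compact_open_fam_compactP (@pdual_cts w)) fam_cvgP.
split=> [H K e cK e0|H K cK A].
  apply: (H K cK [set h | forall x, K x -> `|w x - h x| < e]).
  apply/uniform_nbhs; exists [set xy | ball xy.1 e xy.2].
  by split=> //; exact: entourage_ball (PosNum e0).
move=> /uniform_nbhs[E [entE EA]]; apply: (@filterS _ (r @ F) _ _ _ EA).
move: entE; rewrite -entourage_ballE => -[e /= e0 eE].
apply: filterS (H K e cK e0) => t tw x Kx; apply: eE; exact: tw.
Qed.

Lemma pdual_near (w : pdual) (K : set G) (e : R[i]) : compact K -> 0 < e ->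
  \forall t \near w, forall x, K x -> `|w x - (t : pdual) x| < e.
Proof.
by move=> cK e0; have /(pdual_cvgP w) := @cvg_id _ (nbhs w); apply.
Qed.

Lemma pdual_sub_continuous : continuous (fun z : pdual * pdual => z.1 - z.2).
Proof.
move=> [w t]; apply/pdual_cvgP => K e cK e0.
have e20 : 0 < e / 2 by rewrite divr_gt0.
exists ([set u : pdual | forall x, K x -> `|w x - u x| < e / 2],
  [set u : pdual | forall x, K x -> `|t x - u x| < e / 2]).
  by split; exact: pdual_near.
move=> [w' t'] /= [ww' tt'] x Kx.
have -> : w x * (t x)^* - w' x * (t' x)^* =
  (w x - w' x) * (t x)^* + w' x * (t x - t' x)^*.
  by rewrite rmorphB mulrBl mulrBr addrA subrK.
apply: le_lt_trans (ler_normD _ _) _.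
rewrite !normrM !norm_conjC !pdual_norm mulr1 mul1r (splitr e).
by apply: ltrD; [exact: ww'|exact: tt'].
Qed.

HB.instance Definition _ :=
  PreTopologicalNmodule_isTopologicalZmodule.Build pdual pdual_sub_continuous.

End pontryagin_dual.

Section hilbert_modules.
Variables (R : realType) (X : topologicalType).
Local Notation CX := (continuousType X R[i]).

(* Extended-real valued, hence meaningful without compactness of [X]; it is
   the C*-norm of C(X) when [X] is compact. *)
Definition sup_norm (f : CX) : \bar R :=
  ereal_sup (range (fun x => (Normc.normc (f x))%:E)).

Section hilbert_module.
Variables (M : lmodType CX) (ip : M -> M -> CX).

Definition hilbert_norm (m : M) : \bar R := sqrte (sup_norm (ip m m)).

Record hilbert_module : Prop := HilbertModule {
  hilbert_ip_linear : forall n, linear_for *%R (ip^~ n);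
  hilbert_ip_conj : forall m n, ip n m = conj_fun (ip m n);
  hilbert_ip_ge0 : forall m x, 0 <= ip m m x;
  hilbert_ip_eq0 : forall m, ip m m = 0 -> m = 0;
  hilbert_complete : forall u : nat -> M,
    (forall e : R, 0 < e ->
      \forall i & j \near \oo, (hilbert_norm (u i - u j)%R < e%:E)%E) ->
    exists m, (fun i => hilbert_norm (u i - m)) @ \oo --> 0%E }.

End hilbert_module.

Definition hilbert_module_iso (M N : lmodType CX)
    (ipM : M -> M -> CX) (ipN : N -> N -> CX) (f : M -> N) : Prop :=
  [/\ linear f,
      forall n, exists m, f m = n &
      forall m n, ipN (f m) (f n) = ipM m n].

End hilbert_modules.

Section vector_bundles.
Variables (R : realType) (E X : topologicalType) (p : E -> X).

Definition fiber (x : X) : set E := p @^-1` [set x].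

(* Fibers are subtypes of the total space, carrying the subspace topology. *)
Definition fiber_pt (e : E) (x : X) (pe : p e = x) : fiber x :=
  exist _ e (mem_set pe).

Record vector_space_family := VectorSpaceFamily {
  fiber_class : forall x, GRing.Lmodule R[i] (fiber x) }.

Definition fiber_space (S : vector_space_family) (x : X) : lmodType R[i] :=
  GRing.Lmodule.Pack (fiber_class S x).

Definition fiber_val (S : vector_space_family) x (v : fiber_space S x) : E :=
  set_val (v : fiber x).

(* [phi] is the vector component of a homeomorphism over [U], linear on
   fibers, from [p @^-1` U] onto the product of [U] and C^n, and [psi] is the
   inverse homeomorphism; values of [phi] off [p @^-1` U] and of [psi] off [U]
   are irrelevant. The set [U] being open, continuity at its points in the
   ambient space is continuity for the subspace topology. *)
Record local_trivialization (S : vector_space_family) (U : set X) (n : nat)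
    (phi : E -> 'rV[R[i]]_n) (psi : X -> 'rV[R[i]]_n -> E) : Prop :=
  LocalTrivialization {
  triv_open : open U;
  triv_phi_continuous : {in p @^-1` U, continuous phi};
  triv_psi_continuous :
    {in U `*` setT, continuous (fun xv => psi xv.1 xv.2)};
  triv_projK : forall x v, U x -> p (psi x v) = x;
  triv_psiK : forall x v, U x -> phi (psi x v) = v;
  triv_phiK : forall e, U (p e) -> psi (p e) (phi e) = e;
  triv_linear : forall x, U x ->
    linear (fun v : fiber_space S x => phi (fiber_val v)) }.

Record vector_bundle := VectorBundle {
  bundle_family :> vector_space_family;
  bundle_proj_continuous : continuous p;
  bundle_trivial : forall x, exists (U : set X) (n : nat)
    (phi : E -> 'rV[R[i]]_n) (psi : X -> 'rV[R[i]]_n -> E),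
    U x /\ local_trivialization bundle_family U phi psi }.

Definition fiber_prod : set (E * E) := [set ee | p ee.1 = p ee.2].

Lemma fiber_prodP (ee : fiber_prod) : p (\val ee).1 = p (\val ee).2.
Proof. exact: set_mem (valP ee). Qed.

Record hermitian_bundle := HermitianBundle {
  hermitian_vb :> vector_bundle;
  fiber_ip : forall x, fiber_space hermitian_vb x ->
    fiber_space hermitian_vb x -> R[i];
  fiber_ip_linear : forall x (v : fiber_space hermitian_vb x),
    linear_for *%R (fun u => fiber_ip u v);
  fiber_ip_conj : forall x (u v : fiber_space hermitian_vb x),
    fiber_ip v u = (fiber_ip u v)^*;
  fiber_ip_gt0 : forall x (v : fiber_space hermitian_vb x),
    v != 0 -> 0 < fiber_ip v v;
  fiber_ip_continuous : continuous (fun ee : fiber_prod =>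
    fiber_ip (fiber_pt (fiber_prodP ee) : fiber_space hermitian_vb _)
             (fiber_pt erefl : fiber_space hermitian_vb _)) }.

Definition line_bundle (B : vector_bundle) : Prop :=
  forall x, exists f : {linear fiber_space B x -> 'rV[R[i]]_1}, bijective f.

Record section (B : vector_bundle) := Section_ {
  section_fun :> forall x, fiber_space B x;
  section_cts : continuous (fun x => fiber_val (section_fun x)) }.

End vector_bundles.

Section sections.
Variables (R : realType) (E X : topologicalType) (p : E -> X).

Section section_module.
Variable B : vector_bundle R p.
Local Notation CX := (continuousType X R[i]).

Lemma fiber_valP x (v : fiber_space B x) : p (fiber_val v) = x.
Proof. exact: set_mem (valP (v : fiber p x)). Qed.

Lemma fiber_ptK x (v : fiber_space B x) (pv : p (fiber_val v) = x) :
  fiber_pt pv = v :> fiber p x.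
Proof. exact/val_inj. Qed.

Lemma sectionP (s t : section B) : (forall x, s x = t x) -> s = t.
Proof.
case: s t => [s cs] [t ct] /= st.
have {}st : s = t by exact: functional_extensionality_dep st.
by subst t; congr Section_; exact: Prop_irrelevance.
Qed.

HB.instance Definition _ := gen_eqMixin (section B).
HB.instance Definition _ := gen_choiceMixin (section B).

Lemma section_continuousP (s : forall x, fiber_space B x) :
  continuous (fun x => fiber_val (s x)) <->
  forall (U : set X) n (phi : E -> 'rV[R[i]]_n) (psi : X -> 'rV[R[i]]_n -> E),
    local_trivialization B U phi psi ->
    {in U, continuous (fun x => phi (fiber_val (s x)))}.
Proof.
split=> [cs U n phi psi T x /set_mem Ux|cs x].
  apply: (continuous_comp (cs x)); apply: (triv_phi_continuous T).
  by apply/mem_set; rewrite /preimage/= fiber_valP.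
have [U [n [phi [psi [Ux T]]]]] := bundle_trivial B x.
have nU : nbhs x U by apply: open_nbhs_nbhs; split=> //; exact: triv_open T.
rewrite /continuous_at -[X in _ --> X](triv_phiK T) ?fiber_valP //.
apply: (@cvg_trans _
  ((fun y => psi y (phi (fiber_val (s y)))) @ nbhs x)).
  apply: near_eq_cvg; apply: filterS nU => y Uy.
  by rewrite -{1}(fiber_valP (s y)) (triv_phiK T) ?fiber_valP.
have := @triv_psi_continuous _ _ _ _ _ _ _ _ _ T (x, phi (fiber_val (s x))).
move=> /(_ (mem_set (conj Ux I))) cpsi.
apply: (cvg_comp (fun y => (y, phi (fiber_val (s y))))
  (fun xv => psi xv.1 xv.2)) cpsi.
apply: (@cvg_pair _ _ _ _ (nbhs x) (nbhs (phi (fiber_val (s x))))).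
  exact: cvg_id.
exact: cs T x (mem_set Ux).
Qed.

Fact section_lin_subproof (f : CX) (s t : section B) :
  continuous (fun x => fiber_val (f x *: s x + t x)).
Proof.
apply/section_continuousP => U n phi psi T x Ux.
have cs := (section_continuousP s).1 (@section_cts _ _ _ _ _ s) _ _ _ _ T x Ux.
have ct := (section_continuousP t).1 (@section_cts _ _ _ _ _ t) _ _ _ _ T x Ux.
have nU : nbhs x U.
  by apply: open_nbhs_nbhs; split; [exact: triv_open T|exact: set_mem].
rewrite /continuous_at (triv_linear T (set_mem Ux)).
apply: (@cvg_trans _ ((fun y => f y *: phi (fiber_val (s y)) +
    phi (fiber_val (t y))) @ nbhs x)).
  by apply: near_eq_cvg; apply: filterS nU => y Uy; rewrite (triv_linear T Uy).
apply: (@cvgD R[i]); last exact: ct.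
by apply: (@cvgZ R[i]); [exact: cts_fun|exact: cs].
Qed.

Definition section_lin f s t : section B :=
  Section_ (@section_lin_subproof f s t).

Fact section_zero_subproof :
  continuous (fun x => fiber_val (0 : fiber_space B x)).
Proof.
apply/section_continuousP => U n phi psi T x Ux.
have nU : nbhs x U.
  by apply: open_nbhs_nbhs; split; [exact: triv_open T|exact: set_mem].
have phi0 y : U y -> phi (fiber_val (0 : fiber_space B y)) = 0.
  move=> Uy; have /= := triv_linear T Uy (-1) 0 0.
  by rewrite scaler0 addr0 scaleN1r addNr.
rewrite /continuous_at phi0; last exact: set_mem.
apply: (@cvg_trans _ ((fun=> 0 : 'rV[R[i]]_n) @ nbhs x)); last exact: cvg_cst.
by apply: near_eq_cvg; apply: filterS nU => y Uy; rewrite phi0.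
Qed.

Definition section_zero : section B := Section_ section_zero_subproof.
Definition section_add s t := section_lin 1 s t.
Definition section_opp s := section_lin (-1) s section_zero.
Definition section_scale f s := section_lin f s section_zero.

Lemma section_addE s t x : section_add s t x = s x + t x.
Proof. by rewrite /= scale1r. Qed.

Lemma section_oppE s x : section_opp s x = - s x.
Proof. by rewrite /= addr0 scaleN1r. Qed.

Lemma section_scaleE f s x : section_scale f s x = f x *: s x.
Proof. by rewrite /= addr0. Qed.

Fact section_addA : associative section_add.
Proof. by move=> r s t; apply/sectionP => x; rewrite !section_addE addrA. Qed.

Fact section_addC : commutative section_add.
Proof. by move=> s t; apply/sectionP => x; rewrite !section_addE addrC. Qed.

Fact section_add0 : left_id section_zero section_add.
Proof. by move=> s; apply/sectionP => x; rewrite section_addE add0r. Qed.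

Fact section_addN : left_inverse section_zero section_opp section_add.
Proof.
by move=> s; apply/sectionP => x; rewrite section_addE section_oppE addNr.
Qed.

HB.instance Definition _ := GRing.isZmodule.Build (section B)
  section_addA section_addC section_add0 section_addN.

Fact section_scaleA f g s :
  section_scale f (section_scale g s) = section_scale (f * g) s.
Proof. by apply/sectionP => x; rewrite !section_scaleE scalerA. Qed.

Fact section_scale1 : left_id 1 section_scale.
Proof. by move=> s; apply/sectionP => x; rewrite section_scaleE scale1r. Qed.

Fact section_scaleDr : right_distributive section_scale +%R.
Proof.
move=> f s t; apply/sectionP => x.
by rewrite [RHS]section_addE !section_scaleE section_addE scalerDr.
Qed.

Fact section_scaleDl s : {morph section_scale^~ s : f g / f + g}.
Proof.
move=> f g; apply/sectionP => x.
by rewrite [RHS]section_addE !section_scaleE scalerDl.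
Qed.

HB.instance Definition _ := GRing.Zmodule_isLmodule.Build CX (section B)
  section_scaleA section_scale1 section_scaleDr section_scaleDl.

End section_module.

Section section_inner_product.
Variable B : hermitian_bundle R p.

Lemma fiber_ipE (ee : fiber_prod p) x (u v : fiber_space B x) :
  (\val ee).1 = fiber_val u -> (\val ee).2 = fiber_val v ->
  fiber_ip (fiber_pt (fiber_prodP ee) : fiber_space B _)
    (fiber_pt erefl : fiber_space B _) = fiber_ip u v.
Proof.
move=> eu ev; have xE : x = p (\val ee).2 by rewrite ev fiber_valP.
subst x; congr fiber_ip; exact/val_inj.
Qed.

Fact section_ip_continuous (s t : section B) :
  continuous (fun x => fiber_ip (s x) (t x)).
Proof.
have st x : (fiber_val (s x), fiber_val (t x)) \in fiber_prod p.
  by apply/mem_set; rewrite /fiber_prod/= !fiber_valP.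
pose g x : fiber_prod p := exist (fun e => e \in fiber_prod p) _ (st x).
have cg : continuous g.
  apply/continuousP => _ [U oU <-]; rewrite -comp_preimage.
  move: U oU; apply/continuousP => x.
  by apply: cvg_pair; exact: section_cts.
have -> : (fun x => fiber_ip (s x) (t x)) = (fun ee : fiber_prod p =>
    fiber_ip (fiber_pt (fiber_prodP ee) : fiber_space B _)
             (fiber_pt erefl : fiber_space B _)) \o g.
  by apply/funext => x; rewrite /= (@fiber_ipE (g x) x (s x) (t x)).
by move=> x; apply: (continuous_comp (cg x)); exact: fiber_ip_continuous.
Qed.

Definition section_ip (s t : section B) : continuousType X R[i] :=
  mkcts (@section_ip_continuous s t).

End section_inner_product.
End sections.

Section subgroup_quotients.
Variables (M : topologicalZmodType) (H : zmodClosed M).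
Local Notation MH := (quotient_topology (Quotient.quot H)).

Lemma quot_eqP (x y : M) : reflect (\pi_MH x = \pi_MH y) (x - y \in H).
Proof.
by rewrite (Quotient.idealrBE H); apply: (iffP eqP).
Qed.

Lemma quot_pi_open (U : set M) : open U -> open (\pi_MH @` U).
Proof.
move=> oU; rewrite /open/= /quotient_open.
have -> : \pi_MH @^-1` (\pi_MH @` U) =
    \bigcup_(h in [set` H]) ((fun x => x - h) @^-1` U).
  apply/seteqP; split=> [x [u Uu /esym/quot_eqP xu]|x [h hH Ux]].
    by exists (x - u) => //=; rewrite opprB addrC subrK.
  exists (x - h) => //; apply/quot_eqP.
  by rewrite addrAC subrr sub0r rpredN.
apply: bigcup_open => h _; apply: open_comp oU => x _.
apply: (@continuous_comp _ _ _ (fun x => (x, h))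
  (fun z : M * M => z.1 - z.2)); last exact: sub_continuous.
by apply: cvg_pair; [exact: cvg_id|exact: cvg_cst].
Qed.

Lemma quot_pi_nbhs (x : M) (U : set M) :
  nbhs x U -> nbhs (\pi_MH x) (\pi_MH @` U).
Proof.
rewrite !nbhsE => -[V [oV Vx] VU]; exists (\pi_MH @` V).
  by split; [exact: quot_pi_open|exists x].
exact: image_subset.
Qed.

End subgroup_quotients.

Section quasi_periodic_functions.
Variables (R : realType) (G : topologicalZmodType) (L : zmodClosed G).
Local Notation D := (pdual R G).

Definition lattice : Prop :=
  (forall x, x \in L -> isolated [set` L] x) /\
  compact [set: quotient_topology (Quotient.quot L)].

Definition annihilator : {pred D} :=
  fun t => `[< forall l, l \in L -> t l = 1 >].

Fact annihilator_zmod_closed : zmod_closed annihilator.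
Proof.
split=> [|t u /asboolP t1 /asboolP u1]; apply/asboolP => l lL //=.
by rewrite t1 ?u1 ?mul1r ?rmorph1.
Qed.

HB.instance Definition _ :=
  GRing.isZmodClosed.Build D annihilator annihilator_zmod_closed.

Definition GL : topologicalType := quotient_topology (Quotient.quot L).
Definition DL : topologicalType := quotient_topology (Quotient.quot annihilator).
Definition base_space : topologicalType := (GL * DL)%type.

Definition base_pt (x : G) (w : D) : base_space := (\pi_GL x, \pi_DL w).

Lemma base_continuous (Z : topologicalType) (f : base_space -> Z) :
  continuous (fun z : G * D => f (base_pt z.1 z.2)) -> continuous f.
Proof.
move=> cf [p q]; rewrite -[p]reprK -[q]reprK => A fA.
have [[U V] /= [Ux Vw] UVA] := cf (repr p, repr q) A fA.
exists (\pi_GL @` U, \pi_DL @` V); first by split; exact: quot_pi_nbhs.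
by move=> [a b] /= [[x Ux' <-] [w Vw' <-]]; exact: (UVA (x, w)).
Qed.

Lemma base_pt_continuous : continuous (fun z : G * D => base_pt z.1 z.2).
Proof.
move=> [x w] A [[U V] /= [Ux Vw] UVA].
exists (\pi_GL @^-1` U, \pi_DL @^-1` V) => /=.
  split; first exact: (@pi_continuous _ (Quotient.quot L)).
  exact: (@pi_continuous _ (Quotient.quot annihilator)).
by move=> [x' w'] /= [Ux' Vw']; exact: UVA.
Qed.

Lemma base_ptP x w x' w' : base_pt x w = base_pt x' w' <->
  exists l t, [/\ l \in L, t \in annihilator, x' = x + l & w' = w + t].
Proof.
split=> [[/esym/quot_eqP xx /esym/quot_eqP ww]|[l [t [lL tA -> ->]]]].
  by exists (x' - x), (w' - w); split=> //; rewrite addrC subrK.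
by congr (_, _); apply/esym/quot_eqP; rewrite addrC addKr.
Qed.

(* [G] and its dual are written additively: [x + l] and [w + t] are the
   products of group elements and of characters. *)
Definition quasi_periodic : {pred G * D -> R[i]} := fun F => `[< continuous F /\
  forall x (w : D) l t, l \in L -> t \in annihilator ->
    F (x + l, w + t) = (w l)^* * F (x, w) >].

Fact quasi_periodic_zmod_closed : zmod_closed quasi_periodic.
Proof.
split=> [|F K /asboolP[cF qF] /asboolP[cK qK]]; apply/asboolP; split.
- by move=> z; exact: cvg_cst.
- by move=> *; rewrite mulr0.
- by move=> z; exact: (@cvgB R[i] R[i]) (cF z) (cK z).
- by move=> x w l t lL tA; rewrite mulrBr -(qF x w l t) // -(qK x w l t).
Qed.

HB.instance Definition _ :=
  GRing.isZmodClosed.Build (G * D -> R[i]) quasi_periodic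
    quasi_periodic_zmod_closed.

Record QP := MkQP {
  QP_fun :> G * D -> R[i];
  QP_subproof : QP_fun \in quasi_periodic }.

HB.instance Definition _ := [isSub for QP_fun].
HB.instance Definition _ := [Choice of QP by <:].
HB.instance Definition _ := [SubChoice_isSubZmodule of QP by <:].

Lemma QP_cts (F : QP) : continuous F.
Proof. by case: F => F /= /asboolP[]. Qed.

Lemma QPE (F : QP) x w l t : l \in L -> t \in annihilator ->
  F (x + l, w + t) = (w l)^* * F (x, w).
Proof. by case: F => F /= /asboolP[_]; apply. Qed.

Local Notation CX := (continuousType base_space R[i]).

Fact QP_scale_subproof (f : CX) (F : QP) :
  (fun z => f (base_pt z.1 z.2) * F z) \in quasi_periodic.
Proof.
apply/asboolP; split=> [z|x w l t lL tA].
  apply: (@cvgM R[i]); last exact: QP_cts.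
  by apply: (continuous_comp (base_pt_continuous (x := z))); exact: cts_fun.
rewrite QPE // mulrCA; congr (_ * (f _ * _)).
by apply/esym/base_ptP; exists l, t.
Qed.

Definition QP_scale (f : CX) (F : QP) : QP := MkQP (QP_scale_subproof f F).

Fact QP_scaleA f g F : QP_scale f (QP_scale g F) = QP_scale (f * g) F.
Proof. by apply/val_inj/funext => z /=; rewrite mulrA. Qed.

Fact QP_scale1 : left_id 1 QP_scale.
Proof. by move=> F; apply/val_inj/funext => z /=; rewrite mul1r. Qed.

Fact QP_scaleDr : right_distributive QP_scale +%R.
Proof. by move=> f F K; apply/val_inj/funext => z /=; rewrite mulrDr. Qed.

Fact QP_scaleDl F : {morph QP_scale^~ F : f g / f + g}.
Proof. by move=> f g; apply/val_inj/funext => z /=; rewrite mulrDl. Qed.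

HB.instance Definition _ := GRing.Zmodule_isLmodule.Build CX QP
  QP_scaleA QP_scale1 QP_scaleDr QP_scaleDl.

(* Evaluated at representatives; see [QP_ip_funE]. *)
Definition QP_ip_fun (F K : QP) (b : base_space) : R[i] :=
  F (repr b.1, repr b.2) * (K (repr b.1, repr b.2))^*.

Lemma QP_ip_funE F K x w :
  QP_ip_fun F K (base_pt x w) = F (x, w) * (K (x, w))^*.
Proof.
rewrite /QP_ip_fun; set x' := repr _; set w' := repr _.
have /base_ptP[l [t [lL tA -> ->]]] : base_pt x w = base_pt x' w'.
  by rewrite /base_pt !reprK.
rewrite !QPE // rmorphM mulrACA -normCK norm_conjC pdual_norm.
by rewrite expr1n mul1r.
Qed.

Fact QP_ip_continuous F K : continuous (QP_ip_fun F K).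
Proof.
apply: base_continuous => z.
have -> : (fun z => QP_ip_fun F K (base_pt z.1 z.2)) =
    (fun z => F z * (K z)^*).
  by apply/funext => -[x w]; rewrite QP_ip_funE.
apply: (@cvgM R[i]); first exact: QP_cts.
by apply: (continuous_comp (QP_cts (x := z))); exact: conjC_continuous.
Qed.

Definition QP_ip (F K : QP) : CX := mkcts (@QP_ip_continuous F K).

Definition bundle_rel (a b : G * D * R[i]) : bool :=
  `[< exists l t, [/\ l \in L, t \in annihilator, b.1.1 = a.1.1 + l,
        b.1.2 = a.1.2 + t & b.2 = (a.1.2 l)^* * a.2] >].

Fact bundle_rel_refl : reflexive bundle_rel.
Proof.
move=> a; apply/asboolP; exists 0, 0.
by split; rewrite ?rpred0 ?addr0 // pdual_pt0 rmorph1 mul1r.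
Qed.

Fact bundle_rel_symm a b : bundle_rel a b -> bundle_rel b a.
Proof.
move: a b => [[x w] z] [[x' w'] z'] /asboolP[l [t /= [lL tA -> -> ->]]].
apply/asboolP; exists (- l), (- t) => /=; split; rewrite ?rpredN ?addrK //.
have tN : t (- l) = 1 by move/asboolP: tA; apply; rewrite rpredN.
by rewrite tN mulr1 pdual_ptN conjCK mulrA -normCK pdual_norm expr1n mul1r.
Qed.

Fact bundle_rel_sym : symmetric bundle_rel.
Proof. by move=> a b; apply/idP/idP; exact: bundle_rel_symm. Qed.

Fact bundle_rel_trans : transitive bundle_rel.
Proof.
move=> [[x2 w2] z2] [[x1 w1] z1] [[x3 w3] z3].
move=> /asboolP[l [t /= [lL tA -> -> ->]]] /asboolP[k [u /= [kL uA -> -> ->]]].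
apply/asboolP; exists (l + k), (t + u); rewrite !rpredD //=; split=> //.
- by rewrite addrA.
- by rewrite addrA.
- have tk : t k = 1 by move/asboolP: tA; apply.
  by rewrite tk mulr1 pdualD mulrA -rmorphM [w1 k * _]mulrC.
Qed.

Canonical bundle_eqv :=
  EquivRel bundle_rel bundle_rel_refl bundle_rel_sym bundle_rel_trans.

Definition bundle_space : topologicalType :=
  quotient_topology {eq_quot bundle_rel}.

Definition bundle_pt (x : G) (w : D) (z : R[i]) : bundle_space :=
  \pi_bundle_space (x, w, z).

Definition bundle_proj (e : bundle_space) : base_space :=
  let a := repr e in base_pt a.1.1 a.1.2.

Lemma bundle_ptP x w z x' w' z' : bundle_pt x w z = bundle_pt x' w' z' <->
  exists l t, [/\ l \in L, t \in annihilator, x' = x + l, w' = w + t &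
    z' = (w l)^* * z].
Proof.
by split=> [/eqmodP/asboolP|xwz]; last by apply/eqmodP/asboolP.
Qed.

Lemma bundle_projE x w z : bundle_proj (bundle_pt x w z) = base_pt x w.
Proof.
rewrite /bundle_proj; case rE : (repr _) => [[x' w'] z'] /=.
have /esym/bundle_ptP[l [t [lL tA -> -> _]]] :
  bundle_pt x' w' z' = bundle_pt x w z by rewrite /bundle_pt -rE reprK.
by apply/esym/base_ptP; exists l, t.
Qed.

Definition bundle_fiber_pt (x : G) (w : D) (z : R[i]) :
    fiber bundle_proj (base_pt x w) :=
  fiber_pt (bundle_projE x w z).

End quasi_periodic_functions.

(* Main.v *)
Require Import Defs.
From HB Require Import structures.
From mathcomp Require Import all_boot all_order all_algebra.
From mathcomp Require Import generic_quotient ring_quotient complex.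
From mathcomp Require Import all_classical all_reals all_analysis.
From mathcomp Require Import ring.

Set Implicit Arguments.
Unset Strict Implicit.
Unset Printing Implicit Defensive.

Import Order.TTheory GRing.Theory Num.Theory numFieldNormedType.Exports.

Local Open Scope classical_set_scope.
Local Open Scope quotient_scope.
Local Open Scope ring_scope.

(** Writing an element of the bundle over ([x], [w]) as [x, w, z] determines
the number z once the representative x of [x] is chosen, and z does not
depend on the representative w: every t in the annihilator of L satisfies
t l = 1 on L. This number is [bundle_coord x e]. Replacing x by x + l
multiplies it by the conjugate of w l, a number of modulus 1, so that the
vector space structure and the inner product that it transports to the fibers
do not depend on the choice of x ([bundle_coord_shift], [bundle_coord_linear],
[bundle_ipE]).

Since L is discrete, every point of G has an open neighbourhood V whose
points are pairwise inequivalent modulo L ([lattice_separating_nbhs]). Each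
class meeting V then has a distinguished representative in V, and the
coordinate with respect to this representative trivializes the bundle over
the image of V times the whole dual quotient
([bundle_local_trivialization]). In the dual direction the trivialization is
global, because coordinates depend on x alone. Continuity on the total space is
checked upstairs, on triples (x, w, z), because the quotient map is open
([bundle_pi_open]); and upstairs the trivializing coordinate is just the
projection to z.

A section s corresponds to the function F (x, w) = bundle_coord x (s ([x],
[w])). Its quasi-periodicity is the transformation rule of coordinates, its
continuity is read in a local trivialization, and F |-> [x, w, F (x, w)] is
the inverse construction; the two inner products agree by the definition of
the inner product on fibers ([QP_section_iso]).

Quasi-periodic functions form a Hilbert module because their Hilbert module
norm is the supremum norm, for which a Cauchy sequence converges uniformly to
a function that is again continuous and quasi-periodic
([QP_hilbert_module]). The Hilbert module axioms pass through a surjective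
linear map that preserves inner products ([hilbert_module_transport]), so the
sections form one too. *)

(** * Transport of Hilbert modules along isomorphisms *)

Section hilbert_transport.
Variables (R : realType) (X : topologicalType).
Local Notation CX := (continuousType X R[i]).
Variables (M N : lmodType CX) (ipM : M -> M -> CX) (ipN : N -> N -> CX).
Variables (f : M -> N) (isof : hilbert_module_iso ipM ipN f).

Lemma hilbert_module_iso_norm m : hilbert_norm ipN (f m) = hilbert_norm ipM m.
Proof. by rewrite /hilbert_norm; case: isof => _ _ ->. Qed.

(** The axioms only involve linear combinations and inner products, and the
values of [f] exhaust [N]. Definiteness passes to [ipN] because a preimage of
a null vector is null, hence zero. *)
Lemma hilbert_module_transport : hilbert_module ipM -> hilbert_module ipN.
Proof.
have [linf surjf ipf] := isof.
have fB m m' : f (m - m') = f m - f m'.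
  by rewrite addrC -scaleN1r linf scaleN1r addrC.
case=> ipL ipC ip_ge0 ip_eq0 compl.
split=> [n a n1 n2|n1 n2|n x|n|u cu].
- have [m <-] := surjf n; have [m1 <-] := surjf n1; have [m2 <-] := surjf n2.
  by rewrite -linf !ipf ipL.
- have [m1 <-] := surjf n1; have [m2 <-] := surjf n2.
  by rewrite !ipf.
- by have [m <-] := surjf n; rewrite ipf.
- have [m <-] := surjf n; rewrite ipf => /ip_eq0 ->.
  by rewrite -(subrr 0) fB subrr.
- have [v vu] := choice (fun i => surjf (u i)).
  have uv i : u i = f (v i) by rewrite vu.
  have [|m cm] := compl v.
    move=> e e0; apply: filterS (cu e e0) => -[i j] /=.
    by rewrite !uv -fB hilbert_module_iso_norm.
  exists (f m); rewrite (_ : (fun i => _) =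
    (fun i => hilbert_norm ipM (v i - m))) //.
  by apply/funext => i; rewrite uv -fB hilbert_module_iso_norm.
Qed.

End hilbert_transport.

(** * Uniform limits of complex-valued functions *)

Section complex_limits.
Local Open Scope complex_scope.
Variable R : realType.

Lemma real_cauchy_limit (u : nat -> R) :
  (forall e, 0 < e -> exists N, forall i j,
     (N <= i)%N -> (N <= j)%N -> `|u i - u j| <= e) ->
  exists l, forall e, 0 < e -> exists N, forall i,
    (N <= i)%N -> `|u i - l| <= e.
Proof.
move=> cu; have : cvg (u @ \oo).
  apply: R_complete; apply: cauchy_exP => e e0.
  have [N uN] := cu (e / 2) (divr_gt0 e0 (ltr0n _ 2)).
  exists (u N); exists N => // i /= Ni.
  apply: le_lt_trans (uN _ _ (leqnn N) Ni) _.
  by rewrite gtr_pMr // invf_lt1 // ltr1n.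
move=> /(@cvgrPdist_le _ R^o) cul; exists (lim (u @ \oo)) => e e0.
have [N _ HN] := cul e e0.
by exists N => i Ni; rewrite distrC; exact: HN.
Qed.

Lemma complex_norm_Im (x : R[i]) : `|complex.Im x|%:C <= `|x|.
Proof.
by case: x => a b; simpc; rewrite -sqrtr_sqr ler_wsqrtr // lerDr sqr_ge0.
Qed.

Lemma complex_norm_le (x : R[i]) :
  `|x| <= (`|complex.Re x| + `|complex.Im x|)%:C.
Proof.
case: x => a b; simpc.
rewrite -[leRHS]ger0_norm ?addr_ge0 // -[leRHS]sqrtr_sqr ler_wsqrtr //.
rewrite sqrrD !real_normK ?num_real // addrAC lerDl.
by rewrite mulrn_wge0 // mulr_ge0.
Qed.

Lemma complex_cauchy_limit (a : nat -> R[i]) :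
  (forall e : R, 0 < e -> exists N, forall i j,
     (N <= i)%N -> (N <= j)%N -> `|a i - a j| <= e%:C) ->
  exists l, forall e : R, 0 < e -> exists N, forall i,
    (N <= i)%N -> `|a i - l| <= e%:C.
Proof.
move=> ca.
have [|r ar] := @real_cauchy_limit (fun i => complex.Re (a i)).
  move=> e /ca[N aN]; exists N => i j Ni Nj; rewrite -raddfB -lecR.
  exact: le_trans (normc_ge_Re _) (aN _ _ Ni Nj).
have [|s as_] := @real_cauchy_limit (fun i => complex.Im (a i)).
  move=> e /ca[N aN]; exists N => i j Ni Nj; rewrite -raddfB -lecR.
  exact: le_trans (complex_norm_Im _) (aN _ _ Ni Nj).
exists (r +i* s) => e e0.
have e20 : 0 < e / 2 by rewrite divr_gt0.
have [N1 rN] := ar _ e20; have [N2 sN] := as_ _ e20.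
exists (maxn N1 N2) => i; rewrite geq_max => /andP[/rN ri /sN si].
apply: le_trans (complex_norm_le _) _; rewrite lecR !raddfB/=.
by rewrite (splitr e) lerD.
Qed.

(** The pointwise limit is a uniform one: in |u i z - u j z| <= e let j go to
infinity at each z separately, at a cost that may depend on z and is absorbed
by the other half of e. *)
Lemma complex_uniform_cauchy_limit (T : Type) (u : nat -> T -> R[i]) :
  (forall e : R, 0 < e -> exists N, forall i j,
     (N <= i)%N -> (N <= j)%N -> forall z, `|u i z - u j z| <= e%:C) ->
  exists f, forall e : R, 0 < e -> exists N, forall i,
    (N <= i)%N -> forall z, `|u i z - f z| <= e%:C.
Proof.
move=> cu.
have /choice[f uf] : forall z, exists l, forall e : R, 0 < e ->
    exists N, forall i, (N <= i)%N -> `|u i z - l| <= e%:C.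
  move=> z; apply: complex_cauchy_limit => e /cu[N uN].
  by exists N => i j Ni Nj; exact: uN.
exists f => e e0; have e20 : 0 < e / 2 by rewrite divr_gt0.
have [N uN] := cu _ e20; exists N => i Ni z.
have [N' fN] := uf z _ e20; set j := maxn N N'.
rewrite -(subrKA (u j z)) (splitr e) rmorphD/=.
apply: le_trans (ler_normD _ _) _.
by apply: lerD; [apply: uN|apply: fN]; rewrite // /j ?leq_maxl ?leq_maxr.
Qed.

Lemma complex_uniform_limit_continuous (T : topologicalType)
    (u : nat -> T -> R[i]) (f : T -> R[i]) :
  (forall i, continuous (u i)) ->
  (forall e : R, 0 < e -> exists N, forall i,
    (N <= i)%N -> forall z, `|u i z - f z| <= e%:C) ->
  continuous f.
Proof.
move=> cu uf z; apply/(@cvgrPdist_le _ R[i]) => e e0.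
have eE : e = (complex.Re e)%:C by rewrite RRe_real // gtr0_real.
have r0 : 0 < complex.Re e / 3 by rewrite divr_gt0 // -ltcR -eE.
have [N fN] := uf _ r0.
have rC : 0 < (complex.Re e / 3)%:C by rewrite ltcR.
have /(@cvgrPdist_le _ R[i])/(_ _ rC) := cu N z.
apply: filterS => z' uz'.
rewrite -(subrKA (u N z)) -(subrKA (u N z') (u N z)) eE.
have -> : complex.Re e =
    complex.Re e / 3 + (complex.Re e / 3 + complex.Re e / 3).
  by field.
rewrite !rmorphD/=; apply: le_trans (ler_normD _ _) _.
apply: lerD; first by rewrite distrC; exact: fN.
by apply: le_trans (ler_normD _ _) _; apply: lerD => //; exact: fN.
Qed.

End complex_limits.

(** * The Hilbert module of quasi-periodic functions *)

Section quasi_periodic_module.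
Local Open Scope complex_scope.
Variables (R : realType) (G : topologicalZmodType) (L : zmodClosed G).

(** The Hilbert module norm is the supremum norm, since the inner product of F
with itself at ([x], [w]) is |F (x, w)| ^+ 2 for any representative. *)
Lemma QP_norm_le (F : QP R L) (e : R) : 0 <= e ->
  (hilbert_norm (@QP_ip R G L) F <= e%:E)%E <-> forall z, `|F z| <= e%:C.
Proof.
move=> e0.
have ipE z : (Normc.normc (QP_ip F F (base_pt L z.1 z.2)))%:C = `|F z| ^+ 2.
  have -> : QP_ip F F (base_pt L z.1 z.2) = `|F z| ^+ 2.
    by case: z => x w; rewrite [LHS]QP_ip_funE -normCK.
  by rewrite -[LHS]/(Num.norm (`|F z| ^+ 2)) normrX normr_id.
rewrite /hilbert_norm.
have -> : e%:E = sqrte (e ^+ 2)%:E by rewrite /= sqrtr_sqr ger0_norm.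
rewrite lee_sqrt ?lee_fin ?sqr_ge0 //; split=> [/ereal_supP Fe z|Fe].
  have /Fe : range (fun b => (Normc.normc (QP_ip F F b))%:E)
      (Normc.normc (QP_ip F F (base_pt L z.1 z.2)))%:E.
    by exists (base_pt L z.1 z.2).
  by rewrite lee_fin -lecR ipE rmorphXn/= ler_pXn2r // nnegrE ?lecR.
apply/ereal_supP => _ [[p q] _ <-]; rewrite -[p]reprK -[q]reprK.
rewrite lee_fin -lecR (ipE (repr p, repr q)) rmorphXn/=.
by rewrite ler_pXn2r ?Fe // nnegrE ?lecR.
Qed.

(** Completeness is the only axiom with content: [QP_norm_le] turns a Cauchy
sequence into a uniformly Cauchy one, and both continuity and the
quasi-periodicity equation survive uniform limits. *)
Lemma QP_hilbert_module : hilbert_module (@QP_ip R G L).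
Proof.
split=> [K f F H|F K|F [p q]|F F0|u cu].
- apply/continuousEP => -[p q]; rewrite -[p]reprK -[q]reprK.
  rewrite Defs.continuousD Defs.continuousM.
  rewrite [LHS]QP_ip_funE [QP_ip F K _]QP_ip_funE [QP_ip H K _]QP_ip_funE.
  by rewrite mulrDl mulrA.
- apply/continuousEP => -[p q]; rewrite -[p]reprK -[q]reprK.
  rewrite [LHS]QP_ip_funE [RHS](congr1 Num.conj (QP_ip_funE F K _ _)).
  by rewrite rmorphM/= conjCK mulrC.
- by rewrite -[p]reprK -[q]reprK [leRHS]QP_ip_funE -normCK exprn_ge0.
- apply/val_inj/funext => -[x w] /=.
  have /(congr1 (fun f : continuousType _ _ => f (base_pt L x w))) := F0.
  rewrite [LHS]QP_ip_funE -normCK => /eqP.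
  by rewrite expf_eq0/= normr_eq0 => /eqP.
- have {}cu (e : R) : 0 < e -> exists N, forall i j,
      (N <= i)%N -> (N <= j)%N -> forall z, `|u i z - u j z| <= e%:C.
    move=> e0; have [[A B] /= [[N1 _ NA] [N2 _ NB]] AB] := cu e e0.
    exists (maxn N1 N2) => i j; rewrite !geq_max => /andP[i1 _] /andP[_ j2] z.
    apply: ((QP_norm_le (u i - u j) (ltW e0)).1 _ z).
    by apply/ltW/(AB (i, j)); split; [exact: NA|exact: NB].
  have [f uf] := complex_uniform_cauchy_limit cu.
  have qf : f \in quasi_periodic L.
    apply/asboolP; split.
      by apply: complex_uniform_limit_continuous uf => i; exact: QP_cts.
    move=> x w l t lL tA; apply/eqP; rewrite -subr_eq0 -normr_le0.
    apply/ler_addgt0Pr => e e0; rewrite add0r.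
    have eE : e = (complex.Re e)%:C by rewrite RRe_real // gtr0_real.
    have r0 : 0 < complex.Re e / 2 by rewrite divr_gt0 // -ltcR -eE.
    have [N fN] := uf _ r0.
    rewrite -(subrKA (u N (x + l, w + t))) eE (splitr (complex.Re e)) rmorphD/=.
    apply: le_trans (ler_normD _ _) _; apply: lerD.
      by rewrite distrC; exact: fN.
    rewrite QPE // -mulrBr normrM norm_conjC pdual_norm mul1r; exact: fN.
  have lim_norm (e : R) : 0 < e ->
      \forall i \near \oo,
        (hilbert_norm (@QP_ip R G L) (u i - MkQP qf) <= e%:E)%E.
    move=> e0; have [N fN] := uf _ e0; exists N => // i Ni.
    by apply/(QP_norm_le _ (ltW e0)) => z; exact: fN.
  have norm_ge0 i : (0 <= hilbert_norm (@QP_ip R G L) (u i - MkQP qf))%E.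
    exact: sqrte_ge0.
  exists (MkQP qf); apply/fine_cvgP; split.
    apply: filterS (lim_norm 1 ltr01) => i ui.
    by rewrite ge0_fin_numE //; exact: le_lt_trans ui (ltry _).
  apply/(@cvgrPdist_le _ R^o) => e e0; apply: filterS (lim_norm e e0) => i ui.
  rewrite /= sub0r normrN ger0_norm ?fine_ge0 // -lee_fin fineK //.
  by rewrite ge0_fin_numE //; exact: le_lt_trans ui (ltry _).
Qed.

End quasi_periodic_module.

(** * The total space and its coordinates *)

Section bundle.
Variables (R : realType) (G : topologicalZmodType) (L : zmodClosed G).
Local Notation D := (pdual R G).
Local Notation E := (bundle_space R L).
Local Notation X := (base_space R L).
Local Notation p := (@bundle_proj R G L).

Lemma pdual_eval_continuous (l : G) : continuous (fun w : D => w l).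
Proof.
move=> w; apply/(@cvgrPdist_lt _ R[i] _ _ (nbhs_filter w)) => e e0.
have := pdual_near w (@compact_set1 _ l) e0.
by apply: (@filterS _ _ (nbhs_filter w)) => t; exact.
Qed.

Definition bundle_translation (l : G) (t : D) (a : G * D * R[i]) :
    G * D * R[i] :=
  (a.1.1 + l, a.1.2 + t, (a.1.2 l)^* * a.2).

Lemma bundle_translation_continuous l t : continuous (bundle_translation l t).
Proof.
move=> [[x w] z].
have cx : (fun a : G * D * R[i] => a.1.1) @ nbhs (x, w, z) --> x.
  by apply: (@cvg_comp _ _ _ fst fst _ (nbhs (x, w))); exact: cvg_fst.
have cw : (fun a : G * D * R[i] => a.1.2) @ nbhs (x, w, z) --> w.
  apply: (@cvg_comp _ _ _ fst snd _ (nbhs (x, w))); first exact: cvg_fst.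
  exact: cvg_snd.
have c1 : (fun a : G * D * R[i] => a.1.1 + l) @ nbhs (x, w, z) --> x + l.
  apply: (@cvg_comp _ _ _ (fun a : G * D * R[i] => (a.1.1, l))
    (fun y : G * G => y.1 + y.2) _ (nbhs (x, l)));
    last exact: (@add_continuous G (x, l)).
  by apply: cvg_pair => //; exact: cvg_cst.
have c2 : (fun a : G * D * R[i] => a.1.2 + t) @ nbhs (x, w, z) --> w + t.
  apply: (@cvg_comp _ _ _ (fun a : G * D * R[i] => (a.1.2, t))
    (fun y : D * D => y.1 + y.2) _ (nbhs (w, t)));
    last exact: (@add_continuous D (w, t)).
  apply: (@cvg_pair _ _ _ _ (nbhs w) (nbhs t)) => //; exact: cvg_cst.
have c3 : (fun a : G * D * R[i] => (a.1.2 l)^* * a.2) @ nbhs (x, w, z)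
    --> (w l)^* * z.
  apply: (@cvgM R[i]); last exact: cvg_snd.
  apply: (@cvg_comp _ _ _ (fun a : G * D * R[i] => a.1.2 l) Num.conj _
    (nbhs (w l))); last exact: conjC_continuous.
  by apply: (@cvg_comp _ _ _ (fun a : G * D * R[i] => a.1.2)
    (fun w : D => w l) _ (nbhs w)) => //; exact: pdual_eval_continuous.
apply: (@cvg_pair _ _ _ _ (nbhs (x + l, w + t)) (nbhs ((w l)^* * z))) c3.
exact: (@cvg_pair _ _ _ _ (nbhs (x + l)) (nbhs (w + t))) c1 c2.
Qed.

Definition bundle_pi (a : G * D * R[i]) : E := bundle_pt L a.1.1 a.1.2 a.2.

Lemma bundle_pi_continuous : continuous bundle_pi.
Proof.
move=> a; have -> : bundle_pi = \pi_E by apply/funext => -[[x w] z].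
exact: (@pi_continuous _ {eq_quot (@bundle_rel R G L)}).
Qed.

(** The equivalence relation is the orbit relation of a group acting by the
homeomorphisms [bundle_translation l t], so the saturation of an open set is a
union of open translates. *)
Lemma bundle_pi_open (A : set (G * D * R[i])) : open A -> open (bundle_pi @` A).
Proof.
move=> oA.
pose T (lt : G * D) := bundle_translation lt.1 lt.2.
have piE : bundle_pi = \pi_E by apply/funext => -[[x w] z].
rewrite /open/= /quotient_open.
have -> : \pi_E @^-1` (bundle_pi @` A) =
    \bigcup_(lt in [set lt : G * D | lt.1 \in L /\ lt.2 \in annihilator L])
      (T lt @^-1` A).
  rewrite -piE; apply/seteqP; split=> [[[x w] z]|[[x w] z]].
    case=> -[[x' w'] z'] A' /esym/bundle_ptP[l [t [lL tA /= xx ww zz]]].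
    by exists (l, t) => //; rewrite /T/bundle_translation/= -xx -ww -zz.
  case=> -[l t] [/= lL tA] TA; exists (T (l, t) (x, w, z)) => //.
  by apply/esym/bundle_ptP; exists l, t.
apply: bigcup_open => -[l t] _; apply: open_comp oA => -[[x w] z] _.
exact: bundle_translation_continuous.
Qed.

(** Continuity at a single point, and not only global continuity, descends to
the quotient because the quotient map is open. This is needed for maps that
are well behaved over part of the base only. *)
Lemma bundle_continuous_at (Z : topologicalType) (f : E -> Z) a :
  {for a, continuous (f \o bundle_pi)} -> {for bundle_pi a, continuous f}.
Proof.
move=> cf A fA; have : nbhs a ((f \o bundle_pi) @^-1` A) := cf A fA.
rewrite nbhsE => -[V [oV Va] VA].
suff : nbhs (bundle_pi a) (f @^-1` A) by [].
rewrite nbhsE; exists (bundle_pi @` V).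
  by split; [exact: bundle_pi_open|exists a].
by move=> _ [b Vb <-]; exact: VA.
Qed.

Lemma bundle_piP (e : E) : exists a, e = bundle_pi a.
Proof.
by exists (repr e); rewrite -[LHS]reprK /bundle_pi; case: (repr e) => -[].
Qed.

Lemma bundle_proj_continuous : continuous p.
Proof.
move=> e; have [[[x w] z] ->] := bundle_piP e; apply: bundle_continuous_at.
have -> : p \o bundle_pi = (fun z => base_pt L z.1 z.2) \o fst.
  by apply/funext => -[[x' w'] z'] /=; exact: bundle_projE.
by apply: continuous_comp; [exact: cvg_fst|exact: base_pt_continuous].
Qed.

(** The number z such that e = [x, w, z] whenever x represents the first
component of the projection of e: z does not depend on the representative w
of the second one. *)
Definition bundle_coord (x : G) (e : E) : R[i] :=
  let a := repr e in (a.1.2 (x - a.1.1))^* * a.2.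

Lemma bundle_coordE x x' w z : x - x' \in L ->
  bundle_coord x (bundle_pt L x' w z) = (w (x - x'))^* * z.
Proof.
move=> xL; rewrite /bundle_coord; case rE : (repr _) => [[y u] v] /=.
have /esym/bundle_ptP[l [t [lL tA -> -> ->]]] :
  bundle_pt L y u v = bundle_pt L x' w z by rewrite /bundle_pt -rE reprK.
have tx : t (x - (x' + l)) = 1.
  by move/asboolP: tA; apply; rewrite opprD addrA rpredB.
by rewrite /= tx mulr1 mulrA -rmorphM -pdualD opprD addrA subrK.
Qed.

Lemma bundle_coord_pt x w z : bundle_coord x (bundle_pt L x w z) = z.
Proof. by rewrite bundle_coordE subrr ?rpred0 // pdual_pt0 rmorph1 mul1r. Qed.

Lemma bundle_pt_coord x w e : p e = base_pt L x w ->
  bundle_pt L x w (bundle_coord x e) = e.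
Proof.
have [[[x' w'] z] ->] := bundle_piP e.
rewrite bundle_projE => /base_ptP[l [t [lL tA -> ->]]].
apply/esym/bundle_ptP; exists l, t; split=> //.
by rewrite /bundle_pi/= bundle_coordE addrAC subrr add0r.
Qed.

Lemma bundle_coord_shift x w l e : l \in L -> p e = base_pt L x w ->
  bundle_coord (x + l) e = (w l)^* * bundle_coord x e.
Proof.
move=> lL pe; rewrite -{1}(bundle_pt_coord pe).
by rewrite bundle_coordE addrAC subrr add0r.
Qed.

Lemma repr_base_pt (b : X) : base_pt L (repr b.1) (repr b.2) = b.
Proof. by case: b => b1 b2; rewrite /base_pt !reprK. Qed.

(** Coordinates for two representatives of the same class differ by a phase
common to the whole fiber. This makes the structures defined below from the
canonical representative independent of that choice. *)
Lemma bundle_coord_unit x (b : X) : b.1 = \pi_(GL L) x ->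
  exists2 c : R[i], `|c| = 1 &
    forall e, p e = b -> bundle_coord x e = c * bundle_coord (repr b.1) e.
Proof.
move=> bx; set y := repr b.1; set w : D := repr b.2.
have xyL : x - y \in L by apply/quot_eqP; rewrite -bx reprK.
exists (w (x - y))^*; first by rewrite norm_conjC pdual_norm.
move=> e pe; rewrite -(@bundle_coord_shift y w) ?pe ?repr_base_pt //.
by rewrite addrC subrK.
Qed.

(** * Fibers as complex lines *)

Section fibers.
Variable b : X.

(** A named copy of the fiber, on which algebraic structures can be declared;
they are those of the complex numbers, transported along [fiber_coord]. *)
Definition bundle_fiber : Type := fiber p b.

Definition fiber_coord (u : bundle_fiber) : R[i] :=
  bundle_coord (repr b.1) (set_val (u : fiber p b)).

Fact fiber_of_coord_subproof z : p (bundle_pt L (repr b.1) (repr b.2) z) = b.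
Proof. by rewrite bundle_projE repr_base_pt. Qed.

Definition fiber_of_coord z : bundle_fiber :=
  fiber_pt (fiber_of_coord_subproof z).

Lemma fiber_of_coordK : cancel fiber_of_coord fiber_coord.
Proof. by move=> z; exact: bundle_coord_pt. Qed.

Lemma fiber_coordK : cancel fiber_coord fiber_of_coord.
Proof.
move=> u; apply/val_inj; rewrite /fiber_coord /=.
apply: bundle_pt_coord; rewrite repr_base_pt.
exact: set_mem (valP (u : fiber p b)).
Qed.

Let fiber_add u v := fiber_of_coord (fiber_coord u + fiber_coord v).
Let fiber_opp u := fiber_of_coord (- fiber_coord u).
Let fiber_scale m u := fiber_of_coord (m * fiber_coord u).
Let fiber_zero := fiber_of_coord 0.

HB.instance Definition _ := gen_eqMixin bundle_fiber.
HB.instance Definition _ := gen_choiceMixin bundle_fiber.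

Fact fiber_addA : associative fiber_add.
Proof. by move=> u v w; rewrite /fiber_add !fiber_of_coordK addrA. Qed.

Fact fiber_addC : commutative fiber_add.
Proof. by move=> u v; rewrite /fiber_add addrC. Qed.

Fact fiber_add0 : left_id fiber_zero fiber_add.
Proof. by move=> u; rewrite /fiber_add fiber_of_coordK add0r fiber_coordK. Qed.

Fact fiber_addN : left_inverse fiber_zero fiber_opp fiber_add.
Proof. by move=> u; rewrite /fiber_add fiber_of_coordK addNr. Qed.

HB.instance Definition _ := GRing.isZmodule.Build bundle_fiber
  fiber_addA fiber_addC fiber_add0 fiber_addN.

Fact fiber_scaleA m n u :
  fiber_scale m (fiber_scale n u) = fiber_scale (m * n) u.
Proof. by rewrite /fiber_scale fiber_of_coordK mulrA. Qed.

Fact fiber_scale1 : left_id 1 fiber_scale.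
Proof. by move=> u; rewrite /fiber_scale mul1r fiber_coordK. Qed.

Fact fiber_scaleDr : right_distributive fiber_scale +%R.
Proof.
by move=> m u v; rewrite /fiber_scale /+%R/= /fiber_add !fiber_of_coordK mulrDr.
Qed.

Fact fiber_scaleDl u : {morph fiber_scale^~ u : m n / m + n}.
Proof.
move=> m n.
by rewrite /fiber_scale {2}/+%R/= /fiber_add !fiber_of_coordK mulrDl.
Qed.

HB.instance Definition _ := GRing.Zmodule_isLmodule.Build R[i] bundle_fiber
  fiber_scaleA fiber_scale1 fiber_scaleDr fiber_scaleDl.

Lemma fiber_coord_linear m (u v : bundle_fiber) :
  fiber_coord (m *: u + v) = m * fiber_coord u + fiber_coord v.
Proof. by rewrite [LHS]fiber_of_coordK fiber_of_coordK. Qed.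

End fibers.

Definition bundle_vector_spaces : vector_space_family R p :=
  VectorSpaceFamily (fun b =>
    GRing.Lmodule.class (bundle_fiber b : lmodType R[i])).

Lemma bundle_fiber_proj b (v : fiber_space bundle_vector_spaces b) :
  p (fiber_val v) = b.
Proof. exact: set_mem (valP (v : fiber p b)). Qed.

Lemma bundle_coord_linear x b (m : R[i])
    (u v : fiber_space bundle_vector_spaces b) :
  b.1 = \pi_(GL L) x -> bundle_coord x (fiber_val (m *: u + v)) =
    m * bundle_coord x (fiber_val u) + bundle_coord x (fiber_val v).
Proof.
move=> /bundle_coord_unit[c _ cE].
have lin : bundle_coord (repr b.1) (fiber_val (m *: u + v)) =
    m * bundle_coord (repr b.1) (fiber_val u) +
    bundle_coord (repr b.1) (fiber_val v).
  exact: (fiber_coord_linear m (u : bundle_fiber b) v).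
by rewrite !cE ?bundle_fiber_proj // lin mulrDr mulrCA.
Qed.

End bundle.

(** * Local triviality *)

(** Subtraction is continuous, so a small enough V has V - V inside a
neighbourhood of 0 that meets L in 0 only. *)
Lemma lattice_separating_nbhs (G : topologicalZmodType) (L : zmodClosed G)
    (x0 : G) :
  lattice L ->
  exists V : set G, [/\ open V, V x0 &
    forall x y, V x -> V y -> x - y \in L -> x = y].
Proof.
case=> /(_ 0 (rpred0 L))[_ [W W0 WL]] _.
have : nbhs (x0, x0) ((fun z : G * G => z.1 - z.2) @^-1` W).
  by apply: (@sub_continuous G (x0, x0)); rewrite /= subrr.
case=> -[A B] /= [nA nB] AB.
have : nbhs x0 (A `&` B) by exact: filterI.
rewrite nbhsE => -[V [oV Vx0] VAB].
exists V; split=> // x y /VAB[Ax _] /VAB[_ By] xy.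
have : (W `&` [set` L]) (x - y) by split=> //; exact: (AB (x, y)).
by rewrite WL => /eqP; rewrite subr_eq0 => /eqP.
Qed.

Lemma const_rV1_continuous (T : topologicalType) :
  continuous (fun z : T => const_mx z : 'rV[T]_1).
Proof.
move=> z A [P zP PA]; have := zP 0 0; rewrite mxE; apply: filterS => y Py.
by apply: PA => i j; rewrite mxE !ord1.
Qed.

Section local_triviality.
Variables (R : realType) (G : topologicalZmodType) (L : zmodClosed G).
Local Notation D := (pdual R G).
Local Notation E := (bundle_space R L).
Local Notation X := (base_space R L).
Local Notation p := (@bundle_proj R G L).
Variables (x0 : G) (V : set G).
Hypothesis V_open : open V.
Hypothesis V_sep : forall x y, V x -> V y -> x - y \in L -> x = y.

(** The representative in V of a class meeting V; [x0] is a default value for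
the other classes. *)
Definition local_lift (q : GL L) : G :=
  xget x0 [set x | V x /\ \pi_(GL L) x = q].

Definition trivial_domain : set X := (\pi_(GL L) @` V) `*` setT.

Lemma local_liftK x : V x -> local_lift (\pi_(GL L) x) = x.
Proof.
move=> Vx; rewrite /local_lift; case: xgetP => [y _ [Vy yx]|]; last first.
  by move=> /(_ x) /not_andP[]; rewrite ?Vx.
by apply: V_sep => //; apply/quot_eqP.
Qed.

Lemma trivial_domain_lift b : trivial_domain b ->
  V (local_lift b.1) /\ \pi_(GL L) (local_lift b.1) = b.1.
Proof. by case=> -[x Vx <-] _; rewrite local_liftK. Qed.

Lemma trivial_domain_open : open trivial_domain.
Proof.
have -> : trivial_domain = fst @^-1` (\pi_(GL L) @` V).
  by apply/seteqP; split=> [b []|b] //.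
apply: open_comp => [b _|]; [exact: cvg_fst|exact (@quot_pi_open G L V V_open)].
Qed.

Definition local_coord (e : E) : R[i] := bundle_coord (local_lift (p e).1) e.

Lemma local_coord_pt x w z : V x -> local_coord (bundle_pt L x w z) = z.
Proof.
by move=> Vx; rewrite /local_coord bundle_projE local_liftK // bundle_coord_pt.
Qed.

Lemma trivial_domain_pt e : trivial_domain (p e) ->
  exists x w z, V x /\ e = bundle_pt L x w z.
Proof.
move=> /trivial_domain_lift[Vx xe].
exists (local_lift (p e).1), (repr (p e).2), (local_coord e).
split=> //; rewrite bundle_pt_coord // /base_pt xe reprK.
by case: (p e).
Qed.

(** Near (x, w, z) with x in V, the function is (x', w', z') |-> z' upstairs,
since x' is its own representative in V ([local_coord_pt]). *)
Lemma local_coord_continuous :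
  {in p @^-1` trivial_domain, continuous local_coord}.
Proof.
move=> e /set_mem /trivial_domain_pt[x [w [z [Vx ->]]]].
apply: (@bundle_continuous_at _ _ _ _ _ (x, w, z)).
have cz : (local_coord \o @bundle_pi R G L) (x, w, z) = z.
  exact: local_coord_pt.
suff : (local_coord \o @bundle_pi R G L) @ nbhs (x, w, z) -->
  (local_coord \o @bundle_pi R G L) (x, w, z) by [].
rewrite cz.
have nV : nbhs (x, w, z) [set a : G * D * R[i] | V a.1.1].
  exists (V `*` setT, setT) => /=; last by move=> [[x' w'] z'] [[]].
  split; last exact: filterT.
  exists (V, setT) => //; split; last exact: filterT.
  by apply: open_nbhs_nbhs.
apply: (@cvg_trans _ (snd @ nbhs (x, w, z))); last exact: cvg_snd.
apply: near_eq_cvg; apply: filterS nV => -[[x' w'] z'] /= Vx'.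
by rewrite local_coord_pt.
Qed.

Definition trivial_phi (e : E) : 'rV[R[i]]_1 := const_mx (local_coord e).

Definition trivial_psi (b : X) (v : 'rV[R[i]]_1) : E :=
  bundle_pt L (local_lift b.1) (repr b.2) (v 0 0).

Lemma trivial_psi_pt x w v : V x ->
  trivial_psi (base_pt L x w) v = bundle_pt L x w (v 0 0).
Proof.
move=> Vx; rewrite /trivial_psi /= local_liftK //; set w' := repr _.
apply/bundle_ptP; exists 0, (w - w'); split; rewrite ?rpred0 ?addr0 //.
- by apply/quot_eqP; rewrite reprK.
- by rewrite addrC subrK.
- by rewrite pdual_pt0 rmorph1 mul1r.
Qed.

(** A neighbourhood of [x, w, z] contains the image of a box, and
[trivial_psi_pt] lets a point over the image of the box be written with
representatives taken from the box. *)
Lemma trivial_psi_continuous :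
  {in trivial_domain `*` setT, continuous (fun xv => trivial_psi xv.1 xv.2)}.
Proof.
move=> [b v] /set_mem[/= /trivial_domain_lift[]].
set x := local_lift b.1; set w := repr b.2 => Vx xb _ A.
have -> : b = base_pt L x w by rewrite /base_pt xb reprK; case: (b).
rewrite trivial_psi_pt // => nA.
have [[S Z] /= [[[S1 S2] /= [nS1 nS2] SS] nZ] SZ] :=
  @bundle_pi_continuous _ _ _ (x, w, v 0 0) A nA.
exists ((\pi_(GL L) @` (V `&` S1)) `*` (\pi_(DL R L) @` S2),
  [set v' : 'rV[R[i]]_1 | Z (v' 0 0)]).
  split=> /=.
    exists (\pi_(GL L) @` (V `&` S1), \pi_(DL R L) @` S2) => //.
    split; apply: quot_pi_nbhs => //.
    by apply: filterI => //; exact: open_nbhs_nbhs.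
  exact: (@coord_continuous R[i] 1 1 0 0 v).
move=> [[b1 b2] v'] /= [[[x' [Vx' Sx'] <-] [w' Sw' <-]] Zv'].
rewrite -/(base_pt L x' w') trivial_psi_pt //.
by apply: (SZ (x', w', v' 0 0)); split=> //; exact: (SS (x', w')).
Qed.

Lemma bundle_local_trivialization :
  local_trivialization (bundle_vector_spaces R L) trivial_domain
    trivial_phi trivial_psi.
Proof.
split.
- exact: trivial_domain_open.
- move=> e pe; apply: (@cvg_comp _ _ _ local_coord (fun z => const_mx z) _
    (nbhs (local_coord e))); first exact: local_coord_continuous.
  exact: const_rV1_continuous.
- exact: trivial_psi_continuous.
- move=> [b1 b2] v [/= [x Vx <-] _]; rewrite -[b2]reprK -/(base_pt L x _).
  by rewrite trivial_psi_pt // bundle_projE.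
- move=> [b1 b2] v [/= [x Vx <-] _]; rewrite -[b2]reprK -/(base_pt L x _).
  rewrite trivial_psi_pt // /trivial_phi local_coord_pt //.
  by apply/rowP => i; rewrite mxE ord1.
- move=> e /trivial_domain_pt[x [w [z [Vx ->]]]].
  by rewrite bundle_projE trivial_psi_pt // /trivial_phi local_coord_pt // mxE.
- move=> b Ub m u v; apply/rowP => i; rewrite !mxE /local_coord.
  have [_ pb] := trivial_domain_lift Ub.
  by rewrite !bundle_fiber_proj bundle_coord_linear.
Qed.

End local_triviality.

(** * The Hermitian line bundle *)

Section hermitian_structure.
Variables (R : realType) (G : topologicalZmodType) (L : zmodClosed G).
Hypothesis latL : lattice L.
Local Notation D := (pdual R G).
Local Notation E := (bundle_space R L).
Local Notation X := (base_space R L).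
Local Notation p := (@bundle_proj R G L).
Local Notation fibers := (bundle_vector_spaces R L).

Fact bundle_locally_trivial (b : X) : exists (U : set X) (n : nat)
    (phi : E -> 'rV[R[i]]_n) (psi : X -> 'rV[R[i]]_n -> E),
    U b /\ local_trivialization fibers U phi psi.
Proof.
have [V [oV Vx sepV]] := lattice_separating_nbhs (repr b.1) latL.
exists (@trivial_domain R G L V), 1%N, (@trivial_phi R G L (repr b.1) V),
  (@trivial_psi R G L (repr b.1) V).
split; last exact: bundle_local_trivialization.
by split=> //; exists (repr b.1) => //; rewrite reprK.
Qed.

Definition quasi_vector_bundle : vector_bundle R p :=
  @VectorBundle R E X p fibers (@bundle_proj_continuous R G L)
    bundle_locally_trivial.

Definition bundle_ip b (u v : fiber_space fibers b) : R[i] :=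
  fiber_coord (u : bundle_fiber b) * (fiber_coord (v : bundle_fiber b))^*.

(** The phase by which two coordinates differ cancels against its conjugate. *)
Lemma bundle_ipE x (b : X) (u v : fiber_space fibers b) : b.1 = \pi_(GL L) x ->
  bundle_ip u v =
    bundle_coord x (fiber_val u) * (bundle_coord x (fiber_val v))^*.
Proof.
move=> /bundle_coord_unit[c c1 cE].
rewrite !cE ?bundle_fiber_proj //.
by rewrite rmorphM mulrACA -normCK c1 expr1n mul1r.
Qed.

Fact bundle_ip_linear b (v : fiber_space fibers b) :
  linear_for *%R (fun u => bundle_ip u v).
Proof.
move=> m u u'; rewrite /bundle_ip.
have -> : fiber_coord (m *: u + u' : bundle_fiber b) =
    m * fiber_coord (u : bundle_fiber b) + fiber_coord (u' : bundle_fiber b).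
  exact: fiber_coord_linear.
by rewrite mulrDl -mulrA.
Qed.

Fact bundle_ip_conj b (u v : fiber_space fibers b) :
  bundle_ip v u = (bundle_ip u v)^*.
Proof.
by rewrite /bundle_ip [RHS]rmorphM [RHS]mulrC; congr (_ * _); exact/esym/conjCK.
Qed.

Fact bundle_ip_gt0 b (v : fiber_space fibers b) : v != 0 -> 0 < bundle_ip v v.
Proof.
move=> v0; rewrite /bundle_ip -normCK exprn_gt0 // normr_gt0.
apply: contra v0 => /eqP v0; apply/eqP.
by rewrite -[v](@fiber_coordK R G L b) v0.
Qed.

(** By [bundle_ipE] the inner product may be computed, near a given point of
the fiber product, with the coordinates of a local trivialization, which vary
continuously, whereas canonical representatives do not. *)
Fact bundle_ip_continuous : continuous (fun ee : fiber_prod p =>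
  bundle_ip (fiber_pt (fiber_prodP ee) : fiber_space fibers _)
            (fiber_pt erefl : fiber_space fibers _)).
Proof.
move=> ee; set b := p (\val ee).2; pose x := repr b.1.
have [V [oV Vx sepV]] := lattice_separating_nbhs x latL.
have Ub : @trivial_domain R G L V b.
  by split=> //; exists x => //; rewrite reprK.
have cval : (fun ee : fiber_prod p => \val ee) @ nbhs ee --> \val ee.
  exact: initial_continuous.
have c1 : (fun ee : fiber_prod p => (\val ee).1) @ nbhs ee --> (\val ee).1.
  by apply: (cvg_comp _ _ cval); exact: cvg_fst.
have c2 : (fun ee : fiber_prod p => (\val ee).2) @ nbhs ee --> (\val ee).2.
  by apply: (cvg_comp _ _ cval); exact: cvg_snd.
pose f (ee : fiber_prod p) :=
  local_coord x V (\val ee).1 * (local_coord x V (\val ee).2)^*.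
pose g (ee : fiber_prod p) := bundle_ip
  (fiber_pt (fiber_prodP ee) : fiber_space fibers _)
  (fiber_pt erefl : fiber_space fibers _).
have fE (dd : fiber_prod p) :
    @trivial_domain R G L V (p (\val dd).2) -> f dd = g dd.
  move=> /(trivial_domain_lift x sepV)[_ pb].
  by rewrite /g (bundle_ipE _ _ (esym pb)) /f /local_coord fiber_prodP.
suff : g @ nbhs ee --> g ee by [].
rewrite -fE //.
have nE : {near nbhs ee, f =1 g}.
  have nU : nbhs b (@trivial_domain R G L V).
    by apply: open_nbhs_nbhs; split=> //; exact: trivial_domain_open.
  have : nbhs (\val ee).2 (p @^-1` @trivial_domain R G L V).
    exact: bundle_proj_continuous nU.
  by move=> /c2; apply: (@filterS _ (nbhs ee)); exact: fE.
apply: (@cvg_trans _ (f @ nbhs ee)); first exact: near_eq_cvg nE.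
have cl e : p e = b -> local_coord x V @ nbhs e --> local_coord x V e.
  move=> pe; apply: local_coord_continuous => //.
  by apply/mem_set; rewrite /preimage/= pe.
apply: (@cvgM R[i]).
  by apply: (cvg_comp _ _ c1); apply: cl; exact: fiber_prodP.
apply: (cvg_comp (fun ee : fiber_prod p => local_coord x V (\val ee).2)
  Num.conj);
  last exact: conjC_continuous.
by apply: (cvg_comp _ _ c2); exact: cl.
Qed.

Definition quasi_hermitian_bundle : hermitian_bundle R p :=
  @HermitianBundle R E X p quasi_vector_bundle bundle_ip bundle_ip_linear
    bundle_ip_conj bundle_ip_gt0 bundle_ip_continuous.

Lemma quasi_line_bundle : line_bundle quasi_hermitian_bundle.
Proof.
move=> b; pose f (u : fiber_space quasi_hermitian_bundle b) : 'rV[R[i]]_1 :=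
  const_mx (fiber_coord (u : bundle_fiber b)).
have linf : linear f.
  move=> m u v; apply/rowP => i; rewrite !mxE.
  exact: (fiber_coord_linear m (u : bundle_fiber b) v).
pose fl := GRing.isLinear.Build _ _ _ _ f linf.
pose F : {linear fiber_space quasi_hermitian_bundle b -> 'rV[R[i]]_1} :=
  HB.pack f fl.
exists F; exists (fun v : 'rV[R[i]]_1 => fiber_of_coord b (v 0 0)) => [u|v].
  by rewrite /= /f mxE fiber_coordK.
by apply/rowP => i; rewrite /= /f mxE fiber_of_coordK ord1.
Qed.

End hermitian_structure.

(** * Sections and quasi-periodic functions *)

Section sections_of_quasi_bundle.
Variables (R : realType) (G : topologicalZmodType) (L : zmodClosed G).
Hypothesis latL : lattice L.
Local Notation D := (pdual R G).
Local Notation E := (bundle_space R L).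
Local Notation X := (base_space R L).
Local Notation p := (@bundle_proj R G L).
Local Notation B := (quasi_hermitian_bundle R latL).

Lemma QP_section_val (F : QP R L) x w :
  bundle_pt L (repr (base_pt L x w).1) (repr (base_pt L x w).2)
    (F (repr (base_pt L x w).1, repr (base_pt L x w).2)) =
  bundle_pt L x w (F (x, w)).
Proof.
set y := repr _; set v := repr _.
have /base_ptP[l [t [lL tA yE vE]]] : base_pt L x w = base_pt L y v.
  by rewrite /base_pt !reprK.
by apply/esym/bundle_ptP; exists l, t; split=> //; rewrite yE vE QPE.
Qed.

Fact QP_section_continuous (F : QP R L) : continuous (fun b : X =>
  fiber_val (fiber_of_coord b (F (repr b.1, repr b.2)) : fiber_space B b)).
Proof.
apply: base_continuous => -[x w].
have -> : (fun z : G * D => fiber_val (fiber_of_coord (base_pt L z.1 z.2)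
    (F (repr (base_pt L z.1 z.2).1, repr (base_pt L z.1 z.2).2)) :
      fiber_space B _)) =
    @bundle_pi R G L \o (fun z => (z, F z)).
  by apply/funext => -[x' w']; exact: QP_section_val.
apply: continuous_comp; last exact: bundle_pi_continuous.
apply: (@cvg_pair _ _ _ _ (nbhs (x, w)) (nbhs (F (x, w)))).
  exact: cvg_id.
exact: QP_cts.
Qed.

Definition QP_section (F : QP R L) : section B :=
  @Section_ _ _ _ _ B (fun b => fiber_of_coord b (F (repr b.1, repr b.2)))
    (@QP_section_continuous F).

Lemma QP_sectionE (F : QP R L) x w :
  QP_section F (base_pt L x w) = bundle_fiber_pt L x w (F (x, w)) :> fiber p _.
Proof. by apply/val_inj; exact: QP_section_val. Qed.

Lemma bundle_coord_QP_section (F : QP R L) x w :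
  bundle_coord x (fiber_val (QP_section F (base_pt L x w))) = F (x, w).
Proof. by rewrite QP_sectionE; exact: bundle_coord_pt. Qed.

Lemma fiber_bundle_coord_inj x w (u v : fiber_space B (base_pt L x w)) :
  bundle_coord x (fiber_val u) = bundle_coord x (fiber_val v) -> u = v.
Proof.
move=> uv; apply: val_inj.
have uE : bundle_pt L x w (bundle_coord x (fiber_val u)) = fiber_val u.
  by apply: bundle_pt_coord; exact: (@fiber_valP R E X p B).
have vE : bundle_pt L x w (bundle_coord x (fiber_val v)) = fiber_val v.
  by apply: bundle_pt_coord; exact: (@fiber_valP R E X p B).
by move: vE; rewrite -uv uE.
Qed.

Lemma section_coordP (s t : section B) :
  (forall x w, bundle_coord x (fiber_val (s (base_pt L x w))) =
     bundle_coord x (fiber_val (t (base_pt L x w)))) -> s = t.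
Proof.
move=> st; apply/sectionP => -[b1 b2]; rewrite -[b1]reprK -[b2]reprK.
by apply: (@fiber_bundle_coord_inj (repr b1) (repr b2)); exact: st.
Qed.

Definition section_coord (s : section B) (z : G * D) : R[i] :=
  bundle_coord z.1 (fiber_val (s (base_pt L z.1 z.2))).

(** Quasi-periodicity is [bundle_coord_shift]. For continuity at (x, w), the
varying representative x' may be replaced by the local lift of its class as
long as it stays in V, which turns [section_coord s] into s followed by a
continuous local coordinate. *)
Lemma section_coord_quasi_periodic s : section_coord s \in quasi_periodic L.
Proof.
apply/asboolP; split=> [[x w]|x w l t lL tA]; last first.
  have e : base_pt L (x + l) (w + t) = base_pt L x w.
    by apply/esym/base_ptP; exists l, t.
  rewrite /section_coord/= e.
  by rewrite (@bundle_coord_shift R G L x w) // (@fiber_valP R E X p B).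
have [V [oV Vx sepV]] := lattice_separating_nbhs x latL.
pose f (z : G * D) := local_coord x V (fiber_val (s (base_pt L z.1 z.2))).
have fE (z : G * D) : V z.1 -> f z = section_coord s z.
  move=> Vz; rewrite /f /local_coord (@fiber_valP R E X p B).
  by rewrite local_liftK.
have nE : {near nbhs (x, w), f =1 section_coord s}.
  have : nbhs (x, w) [set z : G * D | V z.1].
    exists (V, setT) => /=; last by move=> [x' w'] [].
    by split; [exact: open_nbhs_nbhs|exact: filterT].
  by apply: (@filterS _ (nbhs (x, w))); exact: fE.
suff : section_coord s @ nbhs (x, w) --> section_coord s (x, w) by [].
rewrite -fE //.
apply: (@cvg_trans _ (f @ nbhs (x, w))); first exact: near_eq_cvg nE.
apply: (@cvg_comp _ _ _ (fun z : G * D => base_pt L z.1 z.2)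
  (fun b => local_coord x V (fiber_val (s b))) _ (nbhs (base_pt L x w))).
  exact: (@base_pt_continuous R G L (x, w)).
apply: (@cvg_comp _ _ _ (fun b => fiber_val (s b)) (local_coord x V) _
  (nbhs (fiber_val (s (base_pt L x w))))); first exact: section_cts.
apply: local_coord_continuous => //; apply/mem_set.
by rewrite /preimage/= (@fiber_valP R E X p B); split=> //; exists x.
Qed.

Lemma QP_section_iso :
  hilbert_module_iso (@QP_ip R G L) (@section_ip R _ _ _ B) QP_section.
Proof.
split=> [f F K|s|F K].
- apply/section_coordP => x w; rewrite bundle_coord_QP_section.
  have -> : (f *: QP_section F + QP_section K) (base_pt L x w) =
      f (base_pt L x w) *: QP_section F (base_pt L x w) +
      QP_section K (base_pt L x w).
    by rewrite [LHS]section_addE section_scaleE.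
  by rewrite bundle_coord_linear // !bundle_coord_QP_section.
- exists (MkQP (section_coord_quasi_periodic s)).
  by apply/section_coordP => x w; rewrite bundle_coord_QP_section.
- apply/continuousEP => -[b1 b2]; rewrite -[b1]reprK -[b2]reprK.
  rewrite [RHS]QP_ip_funE -[LHS]/(bundle_ip _ _).
  rewrite (@bundle_ipE _ _ _ (repr b1)) //.
  by rewrite !bundle_coord_QP_section.
Qed.

End sections_of_quasi_bundle.

Theorem proposition4p5 (R : realType) (G : topologicalZmodType)
    (L : zmodClosed G) :
  hausdorff_space G -> locally_compact [set: G] -> @second_countable G ->
  lattice L ->
  (forall (x : G) (w : pdual R G) (z : R[i]),
     bundle_proj (bundle_pt L x w z) = base_pt L x w) /\
  exists B : hermitian_bundle R (@bundle_proj R G L),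
    let pt x w z : fiber_space B (base_pt L x w) := bundle_fiber_pt L x w z in
    [/\ line_bundle B,
        forall x w z z', pt x w z + pt x w z' = pt x w (z + z'),
        forall x w z m, m *: pt x w z = pt x w (m * z),
        forall x w z z', fiber_ip (pt x w z) (pt x w z') = z * z'^* &
        exists Psi : QP R L -> section B,
          [/\ forall (F : QP R L) x w, Psi F (base_pt L x w) = pt x w (F (x, w)),
              hilbert_module (@QP_ip R G L),
              hilbert_module (@section_ip R _ _ _ B) &
              hilbert_module_iso (@QP_ip R G L) (@section_ip R _ _ _ B) Psi]].
Proof.
move=> _ _ _ latL; split; first exact: bundle_projE.
exists (quasi_hermitian_bundle R latL) => pt.
have ptE x w z : bundle_coord x (fiber_val (pt x w z)) = z.
  exact: bundle_coord_pt.
split.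
- exact: quasi_line_bundle.
- move=> x w z z'; apply: fiber_bundle_coord_inj.
  by rewrite -[pt x w z]scale1r bundle_coord_linear // !ptE mul1r.
- move=> x w z m; apply: fiber_bundle_coord_inj.
  (* reduces scaling to the linearity of coordinates: m = (m - 1) + 1 *)
  rewrite -[m in LHS](subrK 1) scalerDl scale1r bundle_coord_linear // !ptE.
  by rewrite mulrBl mul1r subrK.
- move=> x w z z'; rewrite -[LHS]/(bundle_ip _ _) (@bundle_ipE _ _ _ x) //.
  by rewrite !ptE.
- exists (@QP_section R G L latL); split.
  + exact: QP_sectionE.
  + exact: QP_hilbert_module.
  + have := @hilbert_module_transport R _ _ _ _ _ _ (QP_section_iso R latL).
    by apply; exact: QP_hilbert_module.
  + exact: QP_section_iso.
Qed.
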